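(* For every integer $d\geq 1$, $M(d)\geq \frac{d}{3}$.
   Context: For a number field $K$ and $c\in K$ put $\varphi_c(z)=z^2+c$, viewed as a self-map of $\mathbb{P}^1$ (the point at infinity is fixed). A point $\alpha\in\mathbb{P}^1(K)$ has exact period $n\geq 1$ for $\varphi_c$ if $\varphi_c^n(\alpha)=\alpha$ while $\varphi_c^m(\alpha)\neq\alpha$ for $0<m<n$, where $\varphi_c^n$ denotes the $n$-th iterate. For an integer $d\geq 1$, $M(d)$ denotes the minimal $M$ such that for every number field $K/\mathbb{Q}$ of degree at most $d$ and every $c\in K$, the polynomial $\varphi_c$ has no point defined over $K$ with exact period greater than $M$; set $M(d)=\infty$ if no such finite $M$ exists. Equivalently, $M(d)\in\mathbb{N}\cup\{\infty\}$ is the supremum of the exact periods of $K$-rational periodic points of $\varphi_c$ over all number fields $K$ with $[K:\mathbb{Q}]\leq d$ and all $c\in K$. *)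

(* Defs.v *)
From HB Require Import structures.
From mathcomp Require Import all_boot all_order all_algebra all_field.
From mathcomp Require Import all_classical all_reals ereal.

Set Implicit Arguments.
Unset Strict Implicit.
Unset Printing Implicit Defensive.

Import Order.TTheory GRing.Theory Num.Theory.

Local Open Scope classical_set_scope.
Local Open Scope ring_scope.

(* Number fields are the inhabitants K of [fieldExtType rat]; [\dim {:K}] is
   the degree [K : Q]. *)

(* P^1(K) is K with a point at infinity: [Some z] is the affine point z and
   [None] is infinity, which [omap] fixes. *)
Definition P1 (K : fieldType) : Type := option K.

Definition phi (K : fieldType) (c : K) : P1 K -> P1 K :=
  omap (fun z : K => z ^+ 2 + c).

Definition exact_period (T : Type) (f : T -> T) (n : nat) (x : T) : Prop :=
  [/\ (0 < n)%N, iter n f x = x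
    & forall m : nat, (0 < m < n)%N -> iter m f x <> x].

Definition period_bound (d M : nat) : Prop :=
  forall (K : fieldExtType rat) (c : K), (\dim {:K} <= d)%N ->
  forall (n : nat) (x : P1 K), exact_period (phi c) n x -> (n <= M)%N.

(* The least natural number M such that [period_bound d M], embedded in the
   extended reals; [ereal_inf set0 = +oo] covers the case where there is none. *)
Definition maxPeriod (R : realType) (d : nat) : \bar R :=
  ereal_inf [set (M%:R)%:E | M in [set M : nat | period_bound d M]].

(* Main.v *)
Require Import Defs.
From mathcomp Require Import all_boot all_order all_algebra.
From mathcomp Require Import all_classical all_reals ereal.
From mathcomp Require Import all_field ring zify.

(** For [c = 0] the map is squaring, whose affine cycles other than that of [0]
    consist of roots of unity: a primitive [N]-th root of unity with [N] odd is
    periodic, and its exact period is the multiplicative order of [2] modulo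
    [N] ([exact_period_prim_root]).  This order divides the degree
    of the [N]-th cyclotomic field, so the best [N] are those for which [2] is a
    primitive root.  The powers of [3] form such a family
    ([order_two_mod_exp3]): for [N = 3 ^ k.+1] the period is [2 * 3 ^ k], and
    the field has degree at most [2 * 3 ^ k] because the root is annihilated by
    ['X^(2 * 3 ^ k) + 'X^(3 ^ k) + 1] ([prim_root_exp3_dim]).

    Consecutive members of the family have degrees in ratio [3], so for
    [2 <= d] some [k] satisfies [2 * 3 ^ k <= d < 3 * (2 * 3 ^ k)], which yields
    a period larger than [d / 3] in degree at most [d].  For [d = 1] the fixed
    point at infinity suffices. *)

Import Order.TTheory GRing.Theory Num.Theory.

Local Open Scope ring_scope.
Local Open Scope ereal_scope.

Lemma iter_phi0 (K : fieldType) (m : nat) (z : K) :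
  iter m (phi 0%R) (Some z) = Some (z ^+ (2 ^ m))%R.
Proof.
elim: m => [|m IHm]; first by rewrite expn0 expr1.
by rewrite iterS IHm /= addr0 -exprM -expnSr.
Qed.

(** Squaring [m] times raises [z] to the power [2 ^ m], and two powers of a
    primitive [N]-th root of unity agree exactly when their exponents agree
    modulo [N]; the hypotheses on [n] say that it is the order of [2]. *)
Lemma exact_period_prim_root (K : fieldType) (N n : nat) (z : K) :
    N.-primitive_root%R z -> (0 < n)%N -> 2 ^ n = 1 %[mod N] ->
    (forall m, (0 < m)%N -> 2 ^ m = 1 %[mod N] -> (n <= m)%N) ->
  exact_period (phi 0%R) n (Some z : P1 K).
Proof.
move=> prim_z n_gt0 ord_n min_n.
have fixE m : iter m (phi 0%R) (Some z) = Some z <-> 2 ^ m = 1 %[mod N].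
  rewrite iter_phi0; split=> [[zE] | /eqP modE].
    by apply/eqP; rewrite -(eq_prim_root_expr prim_z) expr1 zE.
  by congr Some; apply/eqP; rewrite -[eqbRHS]expr1 (eq_prim_root_expr prim_z).
split=> //; first exact/fixE.
move=> m /andP[m_gt0 ltmn] /fixE /(min_n m m_gt0).
by rewrite leqNgt ltmn.
Qed.

(** The [p = 3] case of lifting the exponent, with base [4].  Cubing adds exactly
    one factor [3]: with [y = 4 ^ s], [y ^ 3 - 1 = (y - 1) (y ^ 2 + y + 1)], and
    [y = 1 + 3 u] gives [y ^ 2 + y + 1 = 3 (1 + 3 (u + u ^ 2))].  The induction
    on [k] strips these factors, starting from [4] having order [3] modulo
    [9]. *)
Lemma dvdn_exp3_exp4_sub1 (k t : nat) : (3 ^ k.+1 %| 4 ^ t - 1)%N = (3 ^ k %| t)%N.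
Proof.
have mod3 s : 4 ^ s = 1 %[mod 3] by rewrite -modnXm exp1n.
have cube s : exists w, (4 ^ (s * 3) - 1 = (4 ^ s - 1) * (3 * (1 + 3 * w)))%N.
  have [u def_u] : exists u, (4 ^ s = 1 + 3 * u)%N.
    by exists (4 ^ s %/ 3)%N; have := mod3 s; lia.
  by exists (u + u ^ 2)%N; rewrite expnM def_u; nia.
elim: k t => [|k IHk] t.
  by rewrite dvd1n expn1 -eqn_mod_dvd ?expn_gt0 // mod3.
have step s : (3 ^ k.+2 %| 4 ^ (s * 3) - 1)%N = (3 ^ k.+1 %| s * 3)%N.
  have [w ->] := cube s.
  rewrite [in RHS]expnSr dvdn_pmul2r // -IHk.
  rewrite mulnCA expnS dvdn_pmul2l // Gauss_dvdl // coprimeXl //.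
  by rewrite prime_coprime //; lia.
(* When 3 does not divide t, already 9 fails to divide 4 ^ t - 1. *)
have [/dvdnP[s ->] | n3t] := boolP (3 %| t)%N; first exact: step.
have -> : (3 ^ k.+1 %| t)%N = false.
  by apply: contraNF n3t; apply: dvdn_trans; rewrite expnS dvdn_mulr.
apply: contraNF n3t => dvd3.
have dvd9 : (9 %| 4 ^ t - 1)%N.
  by apply: dvdn_trans dvd3; rewrite (dvdn_exp2l 3 (isT : 2 <= k.+2)%N).
have : 4 ^ t = 4 ^ (t %% 3) %[mod 9].
  have cube1 : (4 ^ 3 %% 9)%N = 1%N by [].
  rewrite {1}(divn_eq t 3) expnD [(t %/ 3 * 3)%N]mulnC expnM -modnMml.
  by rewrite -modnXm cube1 exp1n modnMml mul1n.
have := expn_gt0 4 t; rewrite /dvdn.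
by case: (t %% 3)%N (ltn_pmod t (isT : 0 < 3)%N) => [|[|[|]]] //= _; lia.
Qed.

(** That is, [2] is a primitive root modulo every power of [3].  Reduction
    modulo [3] forces the exponent to be even; then [2 ^ m] is a power of [4]
    and [dvdn_exp3_exp4_sub1] applies. *)
Lemma order_two_mod_exp3 (k m : nat) :
  (2 ^ m == 1 %[mod 3 ^ k.+1])%N = (2 * 3 ^ k %| m)%N.
Proof.
have [/dvdnP[t ->] | odd_m] := boolP (2 %| m)%N.
  rewrite eqn_mod_dvd ?expn_gt0 // mulnC expnM dvdn_exp3_exp4_sub1.
  by rewrite dvdn_pmul2l.
have -> : (2 * 3 ^ k %| m)%N = false.
  by apply: contraNF odd_m; apply: dvdn_trans; rewrite dvdn_mulr.
apply: contraNF odd_m => /eqP modE.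
have: 2 ^ m = 1 %[mod 3].
  have dvd3 : (3 %| 3 ^ k.+1)%N by rewrite expnS dvdn_mulr.
  by rewrite -(modn_dvdm _ dvd3) modE modn_dvdm.
have sq1 : (2 ^ 2 %% 3)%N = 1%N by [].
rewrite {1}(divn_eq m 2) expnD [(m %/ 2 * 2)%N]mulnC expnM -modnMml.
rewrite -modnXm sq1 exp1n modnMml mul1n.
by rewrite /dvdn; case: (m %% 2)%N (ltn_pmod m (isT : 0 < 2)%N) => [|[|]].
Qed.

(** An algebraic number lives in the number field that it generates, whose
    degree is that of its minimal polynomial, a divisor of [p]. *)
Lemma numfield_root (z : algC) (p : {poly rat}) :
    p != 0%R -> root (map_poly ratr p) z ->
  exists (K : fieldExtType rat) (f : {rmorphism K -> algC}) (x : K),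
    f x = z /\ (\dim {:K} <= (size p).-1)%N.
Proof.
move=> p_neq0 pz0.
have [K [f [[|x []] //= [fx] genK]]] := num_field_exists [:: z].
exists K, f, x; split=> //.
rewrite -genK adjoin_seq1 dim_Fadjoin dimv1 muln1.
rewrite -ltnS -size_minPoly prednK ?size_poly_gt0 //.
rewrite -(size_map_poly (in_alg K) p) dvdp_leq ?map_poly_eq0 //.
apply: minPoly_dvdp; first exact: alg_polyOver.
rewrite -(fmorph_root f) -map_poly_comp fx.
rewrite (eq_map_poly (g := ratr)) // => a /=.
by rewrite alg_num_field fmorph_rat.
Qed.

(** The polynomial used here is [('X^(3 ^ k.+1) - 1) / ('X^(3 ^ k) - 1)], the
    [3 ^ k.+1]-th cyclotomic polynomial. *)
Lemma prim_root_exp3_dim (k : nat) :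
  exists (K : fieldExtType rat) (x : K),
    (3 ^ k.+1).-primitive_root%R x /\ (\dim {:K} <= 2 * 3 ^ k)%N.
Proof.
have [z prim_z] := C_prim_root_exists (expn_gt0 3 k.+1).
pose p : {poly rat} := ('X^(2 * 3 ^ k) + ('X^(3 ^ k) + 1))%R.
have szp : size p = (2 * 3 ^ k).+1.
  have := expn_gt0 3 k => k3.
  rewrite /p size_polyDl size_polyXn // size_polyDl size_polyXn ?size_poly1; lia.
have p_neq0 : p != 0%R by rewrite -size_poly_eq0 szp.
have pz0 : root (map_poly ratr p) z.
  rewrite !rmorphD rmorph1 /= !map_polyXn rootE !hornerD !hornerXn hornerC mulnC exprM.
  (* w is a cube root of unity other than 1, hence a root of X^2 + X + 1. *)
  set w := (z ^+ (3 ^ k))%R.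
  have w_neq1 : (w - 1 != 0)%R.
    rewrite subr_eq0 -(prim_order_dvd prim_z) gtnNdvd ?expn_gt0 //.
    by rewrite ltn_exp2l.
  rewrite -(mulrI_eq0 _ (mulfI w_neq1)).
  have -> : ((w - 1) * (w ^+ 2 + (w + 1)) = w ^+ 3 - 1)%R by ring.
  by rewrite -exprM -expnSr prim_expr_order ?subrr.
have [K [f [x [fx dimK]]]] := numfield_root z p p_neq0 pz0.
exists K, x; split; last by rewrite szp in dimK.
by rewrite -(fmorph_primitive_root f) fx.
Qed.

Lemma period_bound_ge (d M : nat) :
  (0 < d)%N -> period_bound d M -> (d <= 3 * M)%N.
Proof.
move=> d_gt0 bM.
have [d1 | d_neq1] := eqVneq d 1%N.
  have per : exact_period (phi 0%R) 1 (None : P1 rat^o) by split=> // m; lia.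
  have dim_rat : (\dim {:rat^o} <= d)%N by rewrite dimvf d1.
  have := bM rat^o 0%R dim_rat _ _ per; lia.
(* Halving d first matches the factor 2 in the degree 2 * 3 ^ k. *)
pose k := trunc_log 3 d./2.
have half_d_gt0 : (0 < d./2)%N by lia.
have /andP[lek ltk] := trunc_log_bounds (isT : (1 < 3)%N) half_d_gt0.
rewrite -/k expnS in lek ltk.
have [K [x [prim_x dimK]]] := prim_root_exp3_dim k.
have per : exact_period (phi 0%R) (2 * 3 ^ k) (Some x : P1 K).
  apply: (@exact_period_prim_root K _ _ x prim_x).
  - by rewrite muln_gt0 expn_gt0.
  - by apply/eqP; rewrite order_two_mod_exp3.
  - move=> m m_gt0 /eqP; rewrite order_two_mod_exp3; exact: dvdn_leq.
have degK : (\dim {:K} <= d)%N by lia.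
have := bM K 0%R degK _ _ per.
lia.
Qed.

Theorem proposition4 (R : realType) (d : nat) (hd : (1 <= d)%N) :
  (d%:R / 3%:R)%:E <= maxPeriod R d.
Proof.
apply: le_ereal_inf_tmp => _ [M /= bM <-].
rewrite lee_fin ler_pdivrMr // -natrM ler_nat mulnC.
exact: period_bound_ge.
Qed.
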